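(* Let $X$ be a proper submodule of $M$. Then the following are equivalent: (1) $X$ is $\phi$-prime. (2) For every right ideal $I$ of $R$ and every $Y\in S(M)$: $YI\subseteq X$ and $YI\nsubseteq\phi(X)$ imply $Y\subseteq X$ or $I\subseteq(X:_{R}M)$. (3) For every left ideal $I$ of $R$ and every $Y\in S(M)$: $YI\subseteq X$ and $YI\nsubseteq\phi(X)$ imply $Y\subseteq X$ or $I\subseteq(X:_{R}M)$. (4) For every $a\in R$ and $Y\in S(M)$: $Y(RaR)\subseteq X$ and $Y(RaR)\nsubseteq\phi(X)$ imply $Y\subseteq X$ or $a\in(X:_{R}M)$. (5) For every $a\in R$ and $Y\in S(M)$: $Y(aR)\subseteq X$ and $Y(aR)\nsubseteq\phi(X)$ imply $Y\subseteq X$ or $a\in(X:_{R}M)$. (6) For every $a\in R$ and $Y\in S(M)$: $Y(Ra)\subseteq X$ and $Y(Ra)\nsubseteq\phi(X)$ imply $Y\subseteq X$ or $a\in(X:_{R}M)$.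
   Context: $R$ is an associative ring with identity, not necessarily commutative, and $M$ is a unitary right $R$-module. $S(M)$ is the set of all submodules of $M$; ''ideal'' without qualifier means two-sided ideal. For a submodule $Y$ of $M$ and $I\subseteq R$, $YI$ is the set of finite sums of elements $yr$ with $y\in Y$, $r\in I$. For $a\in R$, $RaR$, $aR$, $Ra$ denote the two-sided, right and left ideals generated by $a$. For submodules $X,Y$, $(Y:_{R}X)=\{r\in R: Xr\subseteq Y\}$. A function $\phi:S(M)\to S(M)\cup\{\emptyset\}$ is fixed, with the standing convention that $\phi(X)\subseteq X$ for every $X\in S(M)$. A proper submodule $X$ of $M$ is $\phi$-prime if for every $Y\in S(M)$ and every ideal $I$ of $R$, $YI\subseteq X$ and $YI\nsubseteq\phi(X)$ imply $Y\subseteq X$ or $I\subseteq(X:_{R}M)$. *)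

(* Defs.v *)
From HB Require Import structures.
From mathcomp Require Import all_boot all_order all_algebra.
From mathcomp Require Import boolp classical_sets.

Set Implicit Arguments.
Unset Strict Implicit.
Unset Printing Implicit Defensive.

Import GRing.Theory.

Local Open Scope classical_set_scope.
Local Open Scope ring_scope.

(* A unitary right R-module is a left module over the converse ring R^c, whose
   product is (x : R^c) * y = (y : R) * (x : R); the zero ring is allowed. *)
Definition ract (R : pzRingType) (M : lmodType R^c) (m : M) (r : R) : M :=
  (r : R^c) *: m.

Definition is_submodule (R : pzRingType) (M : lmodType R^c)
    (X : set M) : Prop :=
  GRing.submod_closed (mem X).

(* By propositional extensionality, submodules with the same elements are equal
   in this type, so functions on it are functions on S(M). *)
Record submodule (R : pzRingType) (M : lmodType R^c) := Submodule {
  submodule_set :> set M;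
  submoduleP : is_submodule submodule_set
}.

(* A value in S(M) \cup {\emptyset}: [None] stands for the empty set. *)
Definition oset (R : pzRingType) (M : lmodType R^c)
  (Z : option (submodule M)) : set M :=
  if Z is Some Z' then submodule_set Z' else set0.

Definition is_right_ideal (R : pzRingType) (I : set R) : Prop :=
  GRing.zmod_closed (mem I) /\ forall x r, I x -> I (x * r).

Definition is_left_ideal (R : pzRingType) (I : set R) : Prop :=
  GRing.zmod_closed (mem I) /\ forall x r, I x -> I (r * x).

Definition is_ideal (R : pzRingType) (I : set R) : Prop :=
  is_left_ideal I /\ is_right_ideal I.

(* RaR, aR and Ra are the least two-sided, right and left ideal containing a. *)
Definition ideal_gen (R : pzRingType) (a : R) : set R :=
  smallest (@is_ideal R) [set a].

Definition right_ideal_gen (R : pzRingType) (a : R) : set R :=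
  smallest (@is_right_ideal R) [set a].

Definition left_ideal_gen (R : pzRingType) (a : R) : set R :=
  smallest (@is_left_ideal R) [set a].

(* YI, the set of finite sums of elements y r *)
Definition mulMI (R : pzRingType) (M : lmodType R^c) (Y : set M) (I : set R) :
    set M :=
  [set z | exists (n : nat) (y : 'I_n -> M) (r : 'I_n -> R),
    [/\ forall i, Y (y i), forall i, I (r i)
      & z = \sum_(i < n) ract (y i) (r i)]].

(* (Y :_R X) *)
Definition colon (R : pzRingType) (M : lmodType R^c) (Y X : set M) : set R :=
  [set r | forall x, X x -> Y (ract x r)].

Definition proper_submodule (R : pzRingType) (M : lmodType R^c)
    (X : submodule M) : Prop :=
  X <> setT :> set M.

Definition phi_prime (R : pzRingType) (M : lmodType R^c)
    (phi : submodule M -> option (submodule M)) (X : submodule M) : Prop :=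
  proper_submodule X /\
  forall (Y : submodule M) (I : set R), is_ideal I ->
    mulMI Y I `<=` X -> ~ (mulMI Y I `<=` oset (phi X)) ->
    Y `<=` X \/ I `<=` colon X [set: M].

(* Main.v *)
Require Import Defs.
From HB Require Import structures.
From mathcomp Require Import all_boot all_order all_algebra.
From mathcomp Require Import boolp classical_sets.

Set Implicit Arguments.
Unset Strict Implicit.
Unset Printing Implicit Defensive.

Local Open Scope classical_set_scope.
Local Open Scope ring_scope.

Import GRing.Theory.

(** Why the theorem holds.  For submodules [Y] and [N], the residual
    [(N :_R Y)] is a two-sided ideal: it is stable under right multiplication
    because [N] is a submodule and under left multiplication because [Y] is
    ([Y (r s) = (Y r) s] lies in [Y s]).  Since [YI] lies in [N] exactly when
    [I] lies in [(N :_R Y)], the condition only sees the two-sided ideal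
    generated by [I] (lemma [mulMI_sub_sandwich]).  The same is true with
    [phi X] in place of [N]: it is either a submodule or empty, and [YI] always
    contains [0], so it is never inside the empty set.  Hence both hypotheses of
    each of the six conditions are unchanged when [I] is replaced by its
    two-sided closure, or [RaR] by [aR] or [Ra].  This gives every implication
    but the passage from principal ideals to arbitrary ones.

    For that last step, suppose that [Y] is not inside [X].  The principal
    condition says that every [a] in [I] lies in [(phi X :_R Y)] or in
    [(X :_R M)], and always in the latter if [phi X] is empty.  Otherwise these
    are additive subgroups, and an additive group covered by two subgroups is
    inside one of them; the first is excluded because [YI] is not inside
    [phi X] (lemma [colon_cover]). *)

Section Residuals.
Variables (R : pzRingType) (M : lmodType R^c).
Implicit Types (N Y : submodule M) (I J : set R).

Lemma ractA (m : M) (r s : R) : ract (ract m r) s = ract m (r * s).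
Proof. by rewrite /ract scalerA. Qed.

Lemma ractBr (m : M) (r s : R) : ract m (r - s) = ract m r - ract m s.
Proof. by rewrite /ract -scalerBl. Qed.

Lemma submodule0 N : submodule_set N 0.
Proof. by have [/[!inE]] := submoduleP N. Qed.

Lemma submodule_lin N (r : R) (u v : M) :
  submodule_set N u -> submodule_set N v -> submodule_set N (ract u r + v).
Proof.
move=> Nu Nv; have [_ Nlin] := submoduleP N.
by have := Nlin r u v; rewrite !inE; apply.
Qed.

Lemma submodule_ract N (r : R) (u : M) :
  submodule_set N u -> submodule_set N (ract u r).
Proof.
by move=> Nu; rewrite -[ract u r]addr0; apply/submodule_lin/submodule0.
Qed.

Lemma submoduleD N (u v : M) :
  submodule_set N u -> submodule_set N v -> submodule_set N (u + v).
Proof. by move=> Nu Nv; have := submodule_lin 1 Nu Nv; rewrite /ract scale1r. Qed.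

Lemma submoduleB N (u v : M) :
  submodule_set N u -> submodule_set N v -> submodule_set N (u - v).
Proof.
move=> Nu Nv; rewrite addrC -[- v]scaleN1r.
exact: (submodule_lin (-1) Nv Nu).
Qed.

Lemma colon_right_ideal N (A : set M) : is_right_ideal (colon N A).
Proof.
split=> [|r s Nr m Am]; last by rewrite -ractA; apply/submodule_ract/Nr.
split=> [|r s]; rewrite !inE.
  by move=> m _; rewrite /ract scale0r; apply: submodule0.
by move=> Nr Ns m Am; rewrite ractBr; apply: submoduleB; [apply: Nr|apply: Ns].
Qed.

Lemma colon_ideal N Y : is_ideal (colon N Y).
Proof.
have Nright := colon_right_ideal N Y; split=> //; split; first by case: Nright.
by move=> r s Nr m Ym; rewrite -ractA; apply/Nr/submodule_ract.
Qed.

Lemma colonB N (A : set M) (r s : R) :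
  colon N A r -> colon N A s -> colon N A (r - s).
Proof.
by move=> Nr Ns m Am; rewrite ractBr; apply: submoduleB; [apply: Nr|apply: Ns].
Qed.

(** The adjunction between product and residual.  The empty value of [Z] is
    excluded on the right because the empty sum [0] belongs to every [YI]. *)
Lemma mulMI_sub_oset Y I (Z : option (submodule M)) :
  mulMI Y I `<=` oset Z <-> exists2 N, Z = Some N & I `<=` colon N Y.
Proof.
split=> [|[N -> IN] _ [n [y [r [Yy Ir ->]]]]]; last first.
  apply: (big_ind (submodule_set N)); [exact: submodule0|exact: submoduleD|].
  by move=> i _; apply: IN.
case: Z => [N|] YIZ; last first.
  suff: mulMI Y I 0 by move=> /YIZ.
  exists 0%N, (fun=> 0), (fun=> 0).
  by split=> [[]|[]|] //; rewrite big_ord0.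
exists N => // r Ir y Yy; apply: YIZ; exists 1%N, (fun=> y), (fun=> r).
by split=> //; rewrite big_ord1.
Qed.

Lemma mulMI_sub Y I N : mulMI Y I `<=` N <-> I `<=` colon N Y.
Proof.
have [sub1 sub2] := mulMI_sub_oset Y I (Some N).
by split=> [/sub1[_ [<-]]|IN] //; apply: sub2; exists N.
Qed.

Lemma smallest_is_ideal I : is_ideal (smallest (@is_ideal R) I).
Proof.
have zmod : GRing.zmod_closed (mem (smallest (@is_ideal R) I)).
  split=> [|r s]; rewrite !inE.
    by move=> J [[[[J0 _] _] _] _]; rewrite inE in J0.
  move=> Ir Is J JI; have [[[[_ JB] _] _] _] := JI.
  by have := JB r s; rewrite !inE; apply; [apply: Ir|apply: Is].
split; split=> // r s Ir J JI; have [[[_ Jl] [_ Jr]] _] := JI.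
  by apply: Jl; apply: Ir.
by apply: Jr; apply: Ir.
Qed.

(** Residuals are two-sided ideals, so one that contains [I] contains the whole
    two-sided ideal generated by [I].  Allowing any intermediate [J] treats
    [RaR], [aR] and [Ra] at once, each compared with the bare set [{a}]. *)
Lemma mulMI_sub_sandwich Y I J (Z : option (submodule M)) :
    I `<=` J -> J `<=` smallest (@is_ideal R) I ->
  mulMI Y J `<=` oset Z <-> mulMI Y I `<=` oset Z.
Proof.
move=> IJ JI; rewrite !mulMI_sub_oset; split=> -[N ZN subN]; exists N => //.
  exact: subset_trans subN.
by apply: (subset_trans JI); apply: smallest_sub => //; apply: colon_ideal.
Qed.

Lemma mulMI_sub_ideal_gen Y (a : R) (Z : option (submodule M)) :
  mulMI Y (ideal_gen a) `<=` oset Z <-> mulMI Y [set a] `<=` oset Z.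
Proof. by apply: mulMI_sub_sandwich => //; apply: sub_gen_smallest. Qed.

Lemma mulMI_sub_right_ideal_gen Y (a : R) (Z : option (submodule M)) :
  mulMI Y (right_ideal_gen a) `<=` oset Z <-> mulMI Y [set a] `<=` oset Z.
Proof.
apply: mulMI_sub_sandwich; first exact: sub_gen_smallest.
apply: smallest_sub; last exact: sub_gen_smallest.
by have [] := smallest_is_ideal [set a].
Qed.

Lemma mulMI_sub_left_ideal_gen Y (a : R) (Z : option (submodule M)) :
  mulMI Y (left_ideal_gen a) `<=` oset Z <-> mulMI Y [set a] `<=` oset Z.
Proof.
apply: mulMI_sub_sandwich; first exact: sub_gen_smallest.
apply: smallest_sub; last exact: sub_gen_smallest.
by have [] := smallest_is_ideal [set a].
Qed.

(** Reduces one-sided ideals to two-sided ones.  Passing to the generated ideal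
    leaves the two hypotheses unchanged and only strengthens the conclusion.
    [P] stands for the alternative [Y `<=` N], which does not mention [I]. *)
Lemma prime_condition_closure N (Z : option (submodule M)) I Y (P : Prop) :
    (mulMI Y (smallest (@is_ideal R) I) `<=` N ->
     ~ (mulMI Y (smallest (@is_ideal R) I) `<=` oset Z) ->
     P \/ smallest (@is_ideal R) I `<=` colon N [set: M]) ->
  mulMI Y I `<=` N -> ~ (mulMI Y I `<=` oset Z) ->
  P \/ I `<=` colon N [set: M].
Proof.
have closure W : mulMI Y (smallest (@is_ideal R) I) `<=` oset W <->
    mulMI Y I `<=` oset W.
  by apply: mulMI_sub_sandwich => //; apply: sub_gen_smallest.
move=> prime YIN YIZ; have [||PY|sub] := prime.
- exact/(closure (Some N)).
- by rewrite closure.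
- by left.
- by right; apply: subset_trans sub; apply: sub_gen_smallest.
Qed.

(** The two-subgroup argument.  The [a] with [Ya] inside [Z] form a subgroup
    [(Z :_R Y)], or the empty set if [Z] is empty.  Some [b] in [I] avoids it;
    if [a] is in it, then [a + b] avoids it too, so [b] and [a + b] are both in
    [(N :_R A)], and hence so is [a]. *)
Lemma colon_cover N (A : set M) (Z : option (submodule M)) I Y :
    (forall a b, I a -> I b -> I (a + b)) ->
    (forall a, I a -> ~ (mulMI Y [set a] `<=` oset Z) -> colon N A a) ->
  ~ (mulMI Y I `<=` oset Z) -> I `<=` colon N A.
Proof.
move=> ID cover YIZ a Ia.
have [YaZ|/(cover a Ia)//] := EM (mulMI Y [set a] `<=` oset Z).
have /mulMI_sub_oset[N' ZN' aN'] := YaZ; have {}aN' := aN' a erefl.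
have [b Ib bN'] : exists2 b, I b & ~ colon N' Y b.
  apply: contra_notP YIZ => Ib; apply/mulMI_sub_oset; exists N' => // b Ib'.
  by apply: contrapT => bN'; apply: Ib; exists b.
have avoid c : ~ colon N' Y c -> ~ (mulMI Y [set c] `<=` oset Z).
  by rewrite ZN' => cN' /mulMI_sub cN; apply/cN'/cN.
rewrite -(addrK b a); apply: colonB; last exact/cover/avoid.
apply: cover; [exact: ID|apply: avoid => abN'].
by apply: bN'; rewrite -(addKr a b) addrC; apply: colonB.
Qed.

End Residuals.

Theorem theorem2 (R : pzRingType) (M : lmodType R^c)
    (phi : submodule M -> option (submodule M))
    (phi_sub : forall Z : submodule M, oset (phi Z) `<=` Z)
    (X : submodule M) (X_proper : proper_submodule X) :
  [<-> phi_prime phi X;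
       forall (I : set R) (Y : submodule M), is_right_ideal I ->
         mulMI Y I `<=` X -> ~ (mulMI Y I `<=` oset (phi X)) ->
         Y `<=` X \/ I `<=` colon X [set: M];
       forall (I : set R) (Y : submodule M), is_left_ideal I ->
         mulMI Y I `<=` X -> ~ (mulMI Y I `<=` oset (phi X)) ->
         Y `<=` X \/ I `<=` colon X [set: M];
       forall (a : R) (Y : submodule M),
         mulMI Y (ideal_gen a) `<=` X ->
         ~ (mulMI Y (ideal_gen a) `<=` oset (phi X)) ->
         Y `<=` X \/ colon X [set: M] a;
       forall (a : R) (Y : submodule M),
         mulMI Y (right_ideal_gen a) `<=` X ->
         ~ (mulMI Y (right_ideal_gen a) `<=` oset (phi X)) ->
         Y `<=` X \/ colon X [set: M] a;
       forall (a : R) (Y : submodule M),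
         mulMI Y (left_ideal_gen a) `<=` X ->
         ~ (mulMI Y (left_ideal_gen a) `<=` oset (phi X)) ->
         Y `<=` X \/ colon X [set: M] a].
Proof.
tfae.
- move=> [_ prime] I Y _; apply: prime_condition_closure.
  exact/prime/smallest_is_ideal.
- move=> prime I Y _; apply: prime_condition_closure.
  by apply: prime; have [] := smallest_is_ideal I.
- move=> prime a Y YaX YaphiX.
  have [|//|//|YX|aX] := prime (ideal_gen a) Y; [|by left|].
    by have [] := smallest_is_ideal [set a].
  by right; apply: aX; apply: sub_gen_smallest.
- move=> prime a Y /(mulMI_sub_right_ideal_gen Y a (Some X)) YaX.
  rewrite mulMI_sub_right_ideal_gen => YaphiX.
  apply: prime; last by rewrite mulMI_sub_ideal_gen.
  exact/(mulMI_sub_ideal_gen Y a (Some X)).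
- move=> prime a Y /(mulMI_sub_left_ideal_gen Y a (Some X)) YaX.
  rewrite mulMI_sub_left_ideal_gen => YaphiX.
  apply: prime; last by rewrite mulMI_sub_right_ideal_gen.
  exact/(mulMI_sub_right_ideal_gen Y a (Some X)).
- move=> prime; split=> // Y I [[Izmod _] _] YIX YIphiX.
  have [YX|notYX] := EM (Y `<=` X); [by left|right].
  apply: (colon_cover _ _ YIphiX) => [a b Ia Ib|a Ia YaphiX].
    have [_ ID] := GRing.zmod_closedD Izmod.
    by have := ID a b; rewrite !inE; apply.
  have [||//|//] := prime a Y; last by rewrite mulMI_sub_left_ideal_gen.
  apply/(mulMI_sub_left_ideal_gen Y a (Some X))/mulMI_sub => _ ->.
  by move/mulMI_sub : YIX; apply.
Qed.
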